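(* Let the smooth component $f$ of the problem $F^\star=\min_{x\in Q}\{F(x)=f(x)+\psi(x)\}$ be Quasi-Self-Concordant with parameter $M\ge0$. Let $\{x_k\}$, $\{g_k\}$ be generated by the Newton Method with Gradient Regularization described in the context, where in each iteration $k\ge0$ the parameter $\sigma_k\in[0,2M]$ is chosen such that $$\langle F'(x_{k+1}),x_k-x_{k+1}\rangle\ \ge\ \frac{g_{k+1}^2}{2\sigma_kg_k}$$ (for example, the constant choice $\sigma_k\equiv M$). Then we have the global linear rate, for $k\ge1$: $$F(x_k)-F^\star\ \le\ \exp\Bigl(-\frac{k}{8MD}\Bigr)\bigl(F(x_0)-F^\star\bigr)+\exp\Bigl(-\frac k4\Bigr)g_0D,$$ where $D=\sup\{\|x-y\|:\ x,y\in Q,\ F(x)\le F(x_0),\ F(y)\le F(x_0)\}$ is the diameter of the initial sublevel set, assumed to satisfy $D<+\infty$.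
   Context: $\mathbb{E}$ is a finite-dimensional real vector space with dual $\mathbb{E}^*$; $\langle s,x\rangle$ denotes the value of $s\in\mathbb{E}^*$ at $x\in\mathbb{E}$. A self-adjoint positive-definite operator $B:\mathbb{E}\to\mathbb{E}^*$ is fixed, with norms $\|h\|=\langle Bh,h\rangle^{1/2}$ on $\mathbb{E}$ and $\|s\|_*=\langle s,B^{-1}s\rangle^{1/2}$ on $\mathbb{E}^*$. For $x\in Q$ write $\|h\|_x=\langle\nabla^2f(x)h,h\rangle^{1/2}$. Problem: $F^\star=\min_{x\in Q}\{F(x)=f(x)+\psi(x)\}$, where $\psi:\mathbb{E}\to\mathbb{R}\cup\{+\infty\}$ is a simple closed convex proper function, $Q=\operatorname{dom}\psi$, and $f:Q\to\mathbb{R}$ is convex and several times differentiable, with gradient $\nabla f(x)$, Hessian $\nabla^2f(x)\succeq0$ and third derivative $D^3f(x)$ (a symmetric trilinear form). A solution of the problem exists. $f$ is Quasi-Self-Concordant with parameter $M\ge0$ if $D^3f(x)[u,u,v]\le M\|u\|_x^2\|v\|$ for all $x$ in the domain of $f$ and all $u,v\in\mathbb{E}$. $\partial F(x)$ is the convex subdifferential of $F$. Newton Method with Gradient Regularization: choose $x_0\in Q$ and set $g_0=\|F'(x_0)\|_*$ for some $F'(x_0)\in\partial F(x_0)$. For $k\ge0$ iterate: for some $\sigma_k\ge0$ compute $$x_{k+1}=\arg\min_{y\in Q}\Bigl\{\langle\nabla f(x_k),y-x_k\rangle+\tfrac12\|y-x_k\|_{x_k}^2+\tfrac{\sigma_kg_k}{2}\|y-x_k\|^2+\psi(y)\Bigr\},$$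 and set $g_{k+1}=\|F'(x_{k+1})\|_*$, where $$F'(x_{k+1})=\nabla f(x_{k+1})-\nabla f(x_k)-\nabla^2f(x_k)(x_{k+1}-x_k)-\sigma_kg_kB(x_{k+1}-x_k)\in\partial F(x_{k+1}).$$ *)

(* Defs.v *)
From HB Require Import structures.
From mathcomp Require Import all_boot all_order all_algebra.
From mathcomp Require Import all_classical all_reals all_analysis.

Set Implicit Arguments.
Unset Strict Implicit.
Unset Printing Implicit Defensive.

Import Order.TTheory GRing.Theory Num.Theory.

Local Open Scope classical_set_scope.
Local Open Scope ring_scope.

Section Euclidean.
Context {R : realType} {E : vectType R}.
Implicit Types (A B : 'Hom(E, 'Hom(E, R^o))) (s : 'Hom(E, R^o)).
Implicit Types (x y h u v w : E) (Q : set E).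

(* The value <s, x>, with codomain R rather than its alias R^o. *)
Definition pairing s x : R := s x.

Definition self_adjoint A := forall u v, pairing (A u) v = pairing (A v) u.

Definition pos_def A := forall u, u != 0 -> 0 < pairing (A u) u.

Definition pos_semidef A := forall u, 0 <= pairing (A u) u.

(* With A = B this is the norm ||h||, with A the Hessian at x it is the
   local norm ||h||_x. *)
Definition pnorm A h : R := Num.sqrt (pairing (A h) h).

(* [lfun_inv] is the inverse of B here, since a positive-definite B is
   injective between spaces of the same dimension. *)
Definition dnorm B s : R := Num.sqrt (pairing s ((B^-1)%VF s)).

(* Frechet derivative L of phi at x along Q. The set Q need not be open; when
   phi is differentiable on a neighbourhood of x, its ordinary derivative
   satisfies this for every Q. *)
Definition diff_within B Q (phi : E -> R) x (L : E -> R) :=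
  forall eps : R, 0 < eps -> exists2 del : R, 0 < del &
    forall y, Q y -> pnorm B (y - x) < del ->
      `|phi y - phi x - L (y - x)| <= eps * pnorm B (y - x).

(* The maps df and d2f take values in finite-dimensional spaces, so their
   Frechet differentiability is that of their coordinates
   <df(y), u> and <d2f(y)u, v>. *)
Definition thrice_diff_on B Q (f : E -> R) (df : E -> 'Hom(E, R^o))
    (d2f : E -> 'Hom(E, 'Hom(E, R^o)))
    (d3f : E -> 'Hom(E, 'Hom(E, 'Hom(E, R^o)))) :=
  forall x, Q x ->
    [/\ diff_within B Q f x (fun h => pairing (df x) h),
        forall u, diff_within B Q (fun y => pairing (df y) u) x
                    (fun h => pairing (d2f x h) u) &
        forall u v, diff_within B Q (fun y => pairing (d2f y u) v) x
                      (fun h => pairing (d3f x h u) v)].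

Definition trilinear_sym (T : 'Hom(E, 'Hom(E, 'Hom(E, R^o)))) :=
  forall u v w, pairing (T u v) w = pairing (T v u) w /\
                pairing (T u v) w = pairing (T u w) v.

Definition quasi_self_concordant B Q (d2f : E -> 'Hom(E, 'Hom(E, R^o)))
    (d3f : E -> 'Hom(E, 'Hom(E, 'Hom(E, R^o)))) (M : R) :=
  forall x, Q x -> forall u v,
    pairing (d3f x u u) v <= M * pnorm (d2f x) u ^+ 2 * pnorm B v.

End Euclidean.

Section Composite.
Context {R : realType} {E : vectType R}.
Implicit Types (B : 'Hom(E, 'Hom(E, R^o))) (x y : E) (F psi : E -> \bar R).

Definition edom psi : set E := [set x | (psi x < +oo)%E].

Definition eproper psi := (forall x, (-oo < psi x)%E) /\ edom psi !=set0.

Definition econvex psi := forall x y (t : R), 0 <= t <= 1 ->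
  (psi (t *: x + (1 - t) *: y)%R
     <= t%:E * psi x + (1 - t)%:E * psi y)%E.

(* Closedness of the epigraph, as lower semicontinuity for ||.||. *)
Definition eclosed B psi := forall x (a : R), (a%:E < psi x)%E ->
  exists2 del : R, 0 < del &
    forall y, pnorm B (y - x) < del -> (a%:E < psi y)%E.

Definition objective (f : E -> R) psi x : \bar R := ((f x)%:E + psi x)%E.

Definition optimal_value F : \bar R := ereal_inf [set F x | x in edom F].

Definition subdifferential F x : set 'Hom(E, R^o) :=
  [set s | F x \is a fin_num /\
           forall y, (F x + (pairing s (y - x))%:E <= F y)%E].

Definition is_argmin (Q : set E) F x := Q x /\ forall y, Q y -> (F x <= F y)%E.

Definition sublevel_diameter B (Q : set E) F x0 : \bar R :=
  ereal_sup [set d | exists x y, [/\ Q x, Q y, (F x <= F x0)%E, (F y <= F x0)%E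
                                   & d = (pnorm B (x - y))%:E]].

Definition newton_model B psi (df : E -> 'Hom(E, R^o))
    (d2f : E -> 'Hom(E, 'Hom(E, R^o))) (c : R) x y : \bar R :=
  ((pairing (df x) (y - x) + 2^-1 * pnorm (d2f x) (y - x) ^+ 2
    + c / 2 * pnorm B (y - x) ^+ 2)%:E + psi y)%E.

(* x k, F' k, g k, sigma k are the iterate x_k, the subgradient F'(x_k), its
   dual norm g_k and the regularization parameter of iteration k. *)
Record newton_grad_reg B (f : E -> R) psi (df : E -> 'Hom(E, R^o))
    (d2f : E -> 'Hom(E, 'Hom(E, R^o)))
    (x : nat -> E) (F' : nat -> 'Hom(E, R^o)) (g sigma : nat -> R) : Prop := {
  ngr_x0 : edom psi (x 0%N);
  ngr_F'0 : subdifferential (objective f psi) (x 0%N) (F' 0%N);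
  ngr_g : forall k, g k = dnorm B (F' k);
  ngr_sigma : forall k, 0 <= sigma k;
  ngr_step : forall k,
    is_argmin (edom psi) (newton_model B psi df d2f (sigma k * g k) (x k))
      (x k.+1);
  ngr_F'S : forall k,
    F' k.+1 = df (x k.+1) - df (x k) - d2f (x k) (x k.+1 - x k)
              - (sigma k * g k) *: B (x k.+1 - x k) }.

(* The quotient is taken in \bar R, where a / 0 = +oo for a > 0 and 0 / 0 = 0:
   if sigma_k g_k = 0 the condition says that g_{k+1} = 0. In R, division by
   zero would yield 0 and make the condition nearly void. *)
Definition sufficient_progress (x : nat -> E) (F' : nat -> 'Hom(E, R^o))
    (g sigma : nat -> R) (k : nat) :=
  ((g k.+1 ^+ 2)%:E / (2 * sigma k * g k)%:E
     <= (pairing (F' k.+1) (x k - x k.+1))%:E)%E.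

End Composite.

(* Main.v *)
Require Import Defs.
From HB Require Import structures.
From mathcomp Require Import all_boot all_order all_algebra.
From mathcomp Require Import all_classical all_reals all_analysis.
From mathcomp Require Import ring lra.

Set Implicit Arguments.
Unset Strict Implicit.
Unset Printing Implicit Defensive.

Import Order.TTheory GRing.Theory Num.Theory.
Import numFieldNormedType.Exports.

Local Open Scope classical_set_scope.
Local Open Scope ring_scope.

(** The method has two regimes at step k. With Fstar the optimal value and D
    the diameter of the initial sublevel set, a subgradient at x_k bounds the
    gap by F(x_k) - Fstar <= g_k D, so if g_k has already dropped below
    exp(-k/4) g_0 the second summand of the bound suffices. If not, the ratios
    rho_i = g_{i+1} / g_i have a geometric mean of at least exp(-1/4). The
    progress condition and sigma_i <= 2M give
    F(x_i) - F(x_{i+1}) >= g_{i+1}^2 / (4 M g_i) = rho_i^2 g_i / (4M), which is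
    at least rho_i^2 (F(x_i) - Fstar) / (4MD): the gap is multiplied by at most
    1 - rho_i^2 / (4MD) <= exp(- rho_i^2 / (4MD)). Since the squares rho_i^2
    average at least exp(-1/2) >= 1/2, the product of these factors is at most
    exp(-k / (8MD)). This numerical argument is [linear_or_gradient_rate].

    What it needs from the problem is that F'(x_k) is a subgradient of F at each
    iterate. Optimality of x_{k+1} in its model, tested to first order along
    segments inside Q, shows that F'(x_{k+1}) minus the gradient of f is a
    subgradient of psi ([newton_step_subgradient]).

    For the constant choice sigma_k = M, put h = x_{k+1} - x_k and r = ||h||.
    Monotonicity of the subdifferential of psi gives
    ||h||_{x_k}^2 + M g_k r^2 <= g_k r. Along the segment,
    quasi-self-concordance bounds the derivative of ||h||_x^2 by
    M r ||h||_x^2, so Gronwall's inequality gives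
    ||h||_x^2 <= exp(M r) ||h||_{x_k}^2, and a second-order
    Taylor estimate bounds the linearization error Delta of the gradient by
    (M/2) exp(M r) ||h||_{x_k}^2 in dual norm ([qsc_gradient_error]). As
    exp(M r) (1 - M r) <= 1, this is at most M g_k r / 2. Finally
    Delta = F'(x_{k+1}) + M g_k B h, and expanding the square of its dual norm
    turns ||Delta||_* <= M g_k r into the progress condition
    ([constant_step_progress]). *)

(** * Dual norms *)

Section Pairing.
Context {R : realType} {E : vectType R}.
Implicit Types (s t : 'Hom(E, R^o)) (u v : E) (a : R).

Lemma pairingDl s t v : pairing (s + t) v = pairing s v + pairing t v.
Proof. exact: add_lfunE. Qed.

Lemma pairingNl s v : pairing (- s) v = - pairing s v.
Proof. exact: opp_lfunE. Qed.

Lemma pairingZl a s v : pairing (a *: s) v = a * pairing s v.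
Proof. exact: scale_lfunE. Qed.

Lemma pairingDr s u v : pairing s (u + v) = pairing s u + pairing s v.
Proof. exact: linearD. Qed.

Lemma pairingNr s v : pairing s (- v) = - pairing s v.
Proof. exact: linearN. Qed.

Lemma pairingZr a s v : pairing s (a *: v) = a * pairing s v.
Proof. exact: linearZ. Qed.

Lemma pairing0r s : pairing s 0 = 0.
Proof. exact: linear0. Qed.

Definition pairingE := (pairingDl, pairingNl, pairingZl, pairingDr, pairingNr,
  pairingZr, pairing0r).

End Pairing.

Section Norms.
Context {R : realType} {E : vectType R}.
Implicit Types (A B : 'Hom(E, 'Hom(E, R^o))) (s : 'Hom(E, R^o)) (u v : E).

Lemma pnorm_sqr A u : pos_semidef A -> pnorm A u ^+ 2 = pairing (A u) u.
Proof. by move=> A0; rewrite /pnorm sqr_sqrtr. Qed.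

Lemma pnorm_ge0 A u : 0 <= pnorm A u.
Proof. exact: sqrtr_ge0. Qed.

Lemma pnormZ A (t : R) u : pnorm A (t *: u) = `|t| * pnorm A u.
Proof.
rewrite /pnorm linearZ/= !pairingE mulrA -expr2 sqrtrM ?sqr_ge0//.
by rewrite sqrtr_sqr.
Qed.

Lemma pnormN A u : pnorm A (- u) = pnorm A u.
Proof. by rewrite -scaleN1r pnormZ normrN1 mul1r. Qed.

Lemma pos_def_semidef B : pos_def B -> pos_semidef B.
Proof.
move=> Bp u; have [->|u0] := eqVneq u 0; last exact/ltW/Bp.
by rewrite pairing0r.
Qed.

(** A positive-definite B is injective, and E and its dual have the same
    dimension, so B is onto and its left inverse is also a right inverse. *)
Lemma pos_def_lfunVK B : pos_def B -> cancel (B^-1)%VF B.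
Proof.
move=> Bp; have kB : lker B == 0%VS.
  apply/lker0P => u v Buv; apply/eqP; rewrite -subr_eq0; apply: contraT.
  by move=> /Bp; rewrite linearB/= Buv subrr /pairing zero_lfunE ltxx.
move=> s; apply: limg_lfunVK.
suff -> : limg B = fullv by exact: memvf.
apply/eqP; rewrite eqEdim subvf/= limg_dim_eq; last first.
  by rewrite (eqP kB) capv0.
by rewrite !dimvf /dim/= muln1.
Qed.

(** The quadratic form of B is nonnegative at <Bv,v> u - <Bu,v> v. *)
Lemma cauchy_schwarz B u v : self_adjoint B -> pos_def B ->
  pairing (B u) v <= pnorm B u * pnorm B v.
Proof.
move=> Bs Bp; have B0 := pos_def_semidef Bp.
have [->|v0] := eqVneq v 0.
  by rewrite pairing0r mulr_ge0// pnorm_ge0.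
rewrite /pnorm -sqrtrM//; apply: (le_trans (ler_norm _)).
rewrite -sqrtr_sqr; apply: ler_wsqrtr.
have c0 := Bp _ v0.
have := B0 (pairing (B v) v *: u - pairing (B u) v *: v).
rewrite linearB/= !linearZ/= !pairingE (Bs v u).
set a := pairing (B u) u; set b := pairing (B u) v.
set c := pairing (B v) v.
rewrite (_ : _ + _ = c * (a * c - b ^+ 2)); last by ring.
by rewrite pmulr_rge0// subr_ge0.
Qed.

Lemma dnorm_ge0 B s : 0 <= dnorm B s.
Proof. exact: sqrtr_ge0. Qed.

Lemma dnormE B s : pos_def B -> dnorm B s = pnorm B ((B^-1)%VF s).
Proof. by move=> Bp; rewrite /dnorm /pnorm pos_def_lfunVK. Qed.

Lemma dnorm_sqr B s : pos_def B -> dnorm B s ^+ 2 = pairing s ((B^-1)%VF s).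
Proof.
move=> Bp; rewrite dnormE// pnorm_sqr ?pos_def_lfunVK//.
exact: pos_def_semidef.
Qed.

Lemma pairing_le_dnorm B s v : self_adjoint B -> pos_def B ->
  pairing s v <= dnorm B s * pnorm B v.
Proof.
move=> Bs Bp; rewrite dnormE// -{1}(pos_def_lfunVK Bp s).
exact: cauchy_schwarz.
Qed.

Lemma dnorm_le B s (c : R) : pos_def B -> 0 <= c ->
  (forall v, pairing s v <= c * pnorm B v) -> dnorm B s <= c.
Proof.
move=> Bp c0 sc; have [->//|d0] := eqVneq (dnorm B s) 0.
have dp : 0 < dnorm B s by rewrite lt_neqAle eq_sym d0 dnorm_ge0.
by rewrite -(ler_pM2r dp) -expr2 dnorm_sqr// [in leRHS]dnormE.
Qed.

Lemma dnorm_eq0 B s : pos_def B -> (dnorm B s == 0) = (s == 0).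
Proof.
move=> Bp; apply/eqP/eqP => [s0|->]; last first.
  by rewrite /dnorm linear0 pairing0r sqrtr0.
rewrite -(pos_def_lfunVK Bp s); apply/eqP; apply: contraTT isT => Bs0.
have u0 : (B^-1)%VF s != 0 by apply: contraNneq Bs0 => ->; rewrite linear0.
have := Bp _ u0; rewrite -pnorm_sqr; last exact: pos_def_semidef.
by rewrite -dnormE// s0 expr0n/= ltxx.
Qed.

End Norms.

(** * Comparison on the unit interval *)

Section UnitInterval.
Context {R : realType}.
Implicit Types (a b : R -> R) (s t : R).

(** Differentiability relative to the closed interval: one-sided at the two
    endpoints, which is what differentiability along a set that need not be
    open yields on a segment of that set. *)
Definition diff01 a a' := forall t, 0 <= t <= 1 -> forall eps : R, 0 < eps ->
  exists2 del : R, 0 < del & forall s, 0 <= s <= 1 -> `|s - t| < del ->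
    `|a s - a t - a' t * (s - t)| <= eps * `|s - t|.

Lemma diff01_continuous a a' : diff01 a a' -> {within `[0, 1], continuous a}.
Proof.
move=> da; apply/subspace_continuousP => t /=; rewrite in_itv/= => t01.
have [del del0 dP] := da t t01 1 ltr01.
have c0 : 0 < 1 + `|a' t| by rewrite ltr_pwDl.
apply/cvgrPdist_le => e e0; rewrite near_withinE; near=> s.
rewrite /= in_itv/= => s01; rewrite distrC.
have : `|t - s| < Num.min del (e / (1 + `|a' t|)).
  near: s; apply: (@cvgr_dist_lt _ _ _ (nbhs t) _ id) => //.
  by rewrite lt_min del0 divr_gt0.
rewrite (distrC t) lt_min ltr_pdivlMr// => /andP[sd se].
have := dP s s01 sd; rewrite mul1r => H.
rewrite -(subrK (a' t * (s - t)) (a s - a t)).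
apply: le_trans (ler_normD _ _) _; rewrite normrM.
apply: le_trans _ (ltW se).
by rewrite [leRHS]mulrDr mulr1 [`|a' t| * _]mulrC lerD2r.
Unshelve. all: by end_near.
Qed.

Lemma diff01_is_derive a a' t : diff01 a a' -> 0 < t < 1 ->
  is_derive t 1 a (a' t).
Proof.
move=> da /andP[t0 t1].
have H : h^-1 *: ((a \o shift t) (h *: 1) - a t) @[h --> 0^'] --> a' t.
  apply/cvgrPdist_le => e e0.
  have [|del del0 dP] := da t _ e e0; first by rewrite !ltW.
  near=> h.
  have h0 : h != 0 by near: h; exact: nbhs_dnbhs_neq.
  have hd : `|h| < Num.min del (Num.min t (1 - t)).
    near: h; by apply: dnbhs0_lt; rewrite !lt_min del0 t0 subr_gt0.
  rewrite /= /shift /= [h *: 1]mulr1.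
  move: hd; rewrite !lt_min => /and3P[hd]; rewrite !ltr_norml.
  move=> /andP[h1 h2] /andP[h3 h4].
  have := dP (h + t); rewrite addrK => /(_ _ hd).
  have -> : 0 <= h + t <= 1 by lra.
  move=> /(_ isT) H; rewrite distrC.
  have -> : h^-1 *: (a (h + t) - a t) - a' t =
            h^-1 * (a (h + t) - a t - a' t * h).
    rewrite /GRing.scale/=. by field.
  by rewrite normrM normfV ler_pdivrMl ?normr_gt0// [leRHS]mulrC.
split; first exact: cvgP H.
exact: cvg_lim H.
Unshelve. all: by end_near.
Qed.

Lemma nonincreasing01 a a' : {within `[0, 1], continuous a} ->
  (forall t, 0 < t < 1 -> is_derive t 1 a (a' t)) ->
  (forall t, 0 < t < 1 -> a' t <= 0) ->
  forall t, 0 <= t <= 1 -> a t <= a 0.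
Proof.
move=> ca da a'0 t t01.
apply: (@ler0_derive1_nincr _ a 0 1) => //; [| |lra..] => s; rewrite in_itv/=.
  by move=> /da[].
by move=> s01; rewrite derive1E; have [_ ->] := da s s01; exact: a'0.
Qed.

Lemma diff01_le a a' b b' : diff01 a a' ->
  (forall t, is_derive t 1 b (b' t)) ->
  (forall t, 0 <= t <= 1 -> a' t <= b' t) ->
  forall t, 0 <= t <= 1 -> a t - a 0 <= b t - b 0.
Proof.
move=> da db ab t t01.
suff : a t - b t <= a 0 - b 0 by lra.
apply: (@nonincreasing01 (fun s => a s - b s) (fun s => a' s - b' s)) => //.
- move=> s; apply: cvgB; first exact: (diff01_continuous da).
  by apply: (derivable_within_continuous (i := `[0, 1])) => r _; case: (db r).
- move=> s s01; have := diff01_is_derive da s01 => ?.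
  exact: is_deriveB.
- by move=> s s01; rewrite subr_le0 ab//; lra.
Qed.

Lemma diff01_le_linear a a' (c : R) : diff01 a a' ->
  (forall t, 0 <= t <= 1 -> a' t <= c) ->
  forall t, 0 <= t <= 1 -> a t <= a 0 + c * t.
Proof.
move=> da ac t t01.
have := @diff01_le a a' (fun s => c * s) (fun=> c) da _ ac t t01.
rewrite mulr0 subr0 -lerBlDl; apply => s.
by apply: is_derive_eq; rewrite /GRing.scale/=; ring.
Qed.

(** A Taylor bound with a constant majorant of the second derivative, obtained
    by comparing twice instead of integrating. *)
Lemma diff01_le_quadratic a a' a'' (c : R) : diff01 a a' -> diff01 a' a'' ->
  (forall t, 0 <= t <= 1 -> a'' t <= c) -> a 1 - a 0 - a' 0 <= c / 2.
Proof.
move=> da da' a''c; have a'_le := diff01_le_linear da' a''c.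
have := @diff01_le a a' (fun s => a' 0 * s + c / 2 * s ^+ 2)
  (fun s => a' 0 + c * s) da _ a'_le 1.
rewrite ler01 lexx expr0n/= expr1n !mulr0 !mulr1 addr0 subr0 [leRHS]addrC.
rewrite -lerBlDr; apply=> // s.
by apply: is_derive_eq; rewrite /GRing.scale/=; field.
Qed.

(** The product of a with the integrating factor exp(-ct) is nonincreasing. *)
Lemma gronwall01 a a' (c : R) : diff01 a a' ->
  (forall t, 0 <= t <= 1 -> a' t <= c * a t) ->
  forall t, 0 <= t <= 1 -> a t <= expR (c * t) * a 0.
Proof.
move=> da a'a t t01.
suff : expR (- (c * t)) * a t <= expR (- (c * 0)) * a 0.
  by rewrite mulr0 oppr0 expR0 mul1r expRN mulrC ler_pdivrMr ?expR_gt0// mulrC.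
apply: (@nonincreasing01 (fun s => expR (- (c * s)) * a s)
  (fun s => expR (- (c * s)) * (a' s - c * a s))) => //.
- move=> s; apply: cvgM; last exact: (diff01_continuous da).
  by apply: (derivable_within_continuous (i := `[0, 1])) => r _.
- move=> s s01; have := diff01_is_derive da s01 => ?.
  by apply: is_derive_eq; rewrite /GRing.scale/=; ring.
- by move=> s s01; rewrite pmulr_rle0 ?expR_gt0// subr_le0 a'a//; lra.
Qed.

End UnitInterval.

Section OneSided.
Context {R : realType}.

Lemma diff01_le_slope (a a' : R -> R) (c : R) : diff01 a a' ->
  (forall t, 0 < t <= 1 -> a t <= a 0 + c * t) -> a' 0 <= c.
Proof.
move=> da ac; rewrite leNgt; apply/negP => ca.
have [||del del0 dP] := da 0 _ ((a' 0 - c) / 2); [by rewrite lexx ler01|lra|].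
pose t := Num.min 1 (del / 2).
have t0 : 0 < t by rewrite lt_min ltr01 divr_gt0.
have t1 : t <= 1 by rewrite ge_min lexx.
have td : t <= del / 2 by rewrite ge_min lexx orbT.
have := dP t; rewrite subr0 (gtr0_norm t0) t1 (ltW t0) => /(_ isT).
have td' : t < del by lra.
move=> /(_ td'); rewrite ler_norml => /andP[+ _].
have := ac t; rewrite t0 t1 => /(_ isT) H1 H2.
have : 0 < (a' 0 - c) * t by rewrite mulr_gt0// subr_gt0.
nra.
Qed.

Lemma diff01N (a a' : R -> R) : diff01 a a' ->
  diff01 (fun t => - a t) (fun t => - a' t).
Proof.
move=> da t t01 e e0; have [d d0 dP] := da t t01 e e0; exists d => // s s01 sd.
have -> : - a s - - a t - - a' t * (s - t) = - (a s - a t - a' t * (s - t)).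
  by ring.
by rewrite normrN; exact: dP.
Qed.

(** The quadratic term is negligible next to the linear one as t tends
    to 0. *)
Lemma ge0_first_order (a b : R) :
  (forall t, 0 < t <= 1 -> 0 <= a * t + b * t ^+ 2) -> 0 <= a.
Proof.
move=> ab; rewrite leNgt; apply/negP => a0.
have b1 : 0 < `|b| + 1 by rewrite ltr_wpDl.
pose t := Num.min 1 (- a / 2 / (`|b| + 1)).
have t0 : 0 < t by rewrite lt_min ltr01 divr_gt0//; lra.
have t1 : t <= 1 by rewrite ge_min lexx.
have tb : t * (`|b| + 1) <= - a / 2 by rewrite -ler_pdivlMr// ge_min lexx orbT.
have bb := ler_norm b.
have := ab t; rewrite t0 t1 => /(_ isT); rewrite expr2 mulrA -mulrDl.
rewrite pmulr_lge0//; nra.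
Qed.

End OneSided.

(** * Functions along segments *)

Section Segments.
Context {R : realType} {E : vectType R}.
Implicit Types (B : 'Hom(E, 'Hom(E, R^o))) (Q : set E) (x y h : E).

Lemma diff_within_segment B Q (phi : E -> R) (L : E -> E -> R) x h :
  (forall t, 0 <= t <= 1 -> Q (x + t *: h)) ->
  (forall y, Q y -> diff_within B Q phi y (L y)) ->
  (forall y (t : R), L y (t *: h) = t * L y h) ->
  diff01 (fun t => phi (x + t *: h)) (fun t => L (x + t *: h) h).
Proof.
move=> Qxh dphi Lh t t01 e e0.
have h1 : 0 < pnorm B h + 1 by rewrite ltr_wpDl// pnorm_ge0.
have [|d d0 dP] := dphi _ (Qxh t t01) (e / (pnorm B h + 1)).
  by rewrite divr_gt0.
(* The added 1 keeps the denominator positive when h = 0. *)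
exists (d / (pnorm B h + 1)); first by rewrite divr_gt0.
move=> s s01; rewrite ltr_pdivlMr// => sd.
have st0 : 0 <= `|s - t| by [].
have := dP _ (Qxh s s01).
rewrite opprD addrACA subrr add0r -scalerBl Lh pnormZ (mulrC (s - t)) => H.
apply: le_trans (H _) _.
  by apply: le_lt_trans sd; rewrite ler_wpM2l// lerDl.
rewrite mulrAC ler_pdivrMr// -mulrA ler_wpM2l ?(ltW e0)// ler_wpM2l//.
by rewrite lerDl.
Qed.

End Segments.

Section Convexity.
Context {R : realType} {E : vectType R}.
Implicit Types (psi : E -> \bar R) (x y : E).

Lemma edom_fin psi x : eproper psi -> edom psi x -> psi x \is a fin_num.
Proof. by move=> [psiNy _] Qx; rewrite fin_numElt psiNy. Qed.

Lemma econvex_segment psi x y (t : R) : eproper psi -> econvex psi ->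
  edom psi x -> edom psi y -> 0 <= t <= 1 ->
  edom psi (x + t *: (y - x)) /\
  fine (psi (x + t *: (y - x))) <=
    fine (psi x) + t * (fine (psi y) - fine (psi x)).
Proof.
move=> pp pc Qx Qy t01; have := pc y x t t01.
rewrite -(fineK (edom_fin pp Qx)) -(fineK (edom_fin pp Qy)).
rewrite -!EFinM -EFinD.
rewrite (_ : t *: y + _ = x + t *: (y - x)); last first.
  by rewrite scalerBl scale1r scalerBr addrCA addrA.
move=> H; have Q : edom psi (x + t *: (y - x)).
  by apply: le_lt_trans H _; rewrite ltry.
split=> //; move: H; rewrite -(fineK (edom_fin pp Q)) lee_fin.
by move=> /le_trans; apply; rewrite mulrBl mul1r addrCA mulrBr.
Qed.

Lemma convex_function_segment (Q : set E) (f : E -> R) x y (t : R) :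
  convex_function (Q : set (convex_lmodType E)) f -> Q x -> Q y ->
  0 <= t <= 1 -> f (x + t *: (y - x)) <= f x + t * (f y - f x).
Proof.
move=> fc Qx Qy t01.
pose ti : {i01 R} := Itv01 (proj1 (andP t01)) (proj2 (andP t01)).
have : f (t *: y + (1 - t) *: x) <= t * f y + (1 - t) * f x.
  exact: (fc ti y x (mem_set Qy) (mem_set Qx)).
rewrite (_ : t *: y + _ = x + t *: (y - x)); last first.
  by rewrite scalerBl scale1r scalerBr addrCA addrA.
by move=> /le_trans; apply; rewrite mulrBl mul1r addrCA mulrBr.
Qed.

End Convexity.

(** * Subgradients and the Newton step *)

Section Composite.
Context {R : realType} {E : vectType R} (B : 'Hom(E, 'Hom(E, R^o)))
  (psi : E -> \bar R) (f : E -> R) (df : E -> 'Hom(E, R^o))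
  (d2f : E -> 'Hom(E, 'Hom(E, R^o)))
  (d3f : E -> 'Hom(E, 'Hom(E, 'Hom(E, R^o))))
  (B_sa : self_adjoint B) (B_pd : pos_def B)
  (psi_proper : eproper psi) (psi_convex : econvex psi)
  (f_diff : thrice_diff_on B (edom psi) f df d2f d3f).
Implicit Types (x y u v : E) (s : 'Hom(E, R^o)).

(** Subgradients of psi, tested only on its domain so that the inequality lives
    in the real numbers. *)
Definition subgradient_dom x s := forall y, edom psi y ->
  fine (psi x) + pairing s (y - x) <= fine (psi y).

Lemma edom_segment x y (t : R) : edom psi x -> edom psi y -> 0 <= t <= 1 ->
  edom psi (x + t *: (y - x)).
Proof.
move=> Qx Qy t01.
by have [] := econvex_segment psi_proper psi_convex Qx Qy t01.
Qed.

Lemma f_segment x y : edom psi x -> edom psi y ->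
  diff01 (fun t => f (x + t *: (y - x)))
         (fun t => pairing (df (x + t *: (y - x))) (y - x)).
Proof.
move=> Qx Qy.
apply: (diff_within_segment (L := fun z => pairing (df z))
  (fun t => edom_segment Qx Qy)) => [z Qz|z t]; last exact: pairingZr.
by have [dfz _ _] := f_diff Qz; exact: dfz.
Qed.

Lemma df_segment x y u : edom psi x -> edom psi y ->
  diff01 (fun t => pairing (df (x + t *: (y - x))) u)
         (fun t => pairing (d2f (x + t *: (y - x)) (y - x)) u).
Proof.
move=> Qx Qy.
apply: (diff_within_segment (phi := fun z => pairing (df z) u)
  (L := fun z h => pairing (d2f z h) u)
  (fun t => edom_segment Qx Qy)) => [z Qz|z t]; last first.
  by rewrite linearZ/= pairingZl.
by have [_ ddfz _] := f_diff Qz; exact: ddfz.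
Qed.

Lemma d2f_segment x y u v : edom psi x -> edom psi y ->
  diff01 (fun t => pairing (d2f (x + t *: (y - x)) u) v)
         (fun t => pairing (d3f (x + t *: (y - x)) (y - x) u) v).
Proof.
move=> Qx Qy.
apply: (diff_within_segment (phi := fun z => pairing (d2f z u) v)
  (L := fun z h => pairing (d3f z h u) v)
  (fun t => edom_segment Qx Qy)) => [z Qz|z t]; last first.
  by rewrite linearZ/= scale_lfunE pairingZl.
by have [_ _ dddfz] := f_diff Qz; exact: dddfz.
Qed.

(** On the segment from x to y the chord lies above f, so its slope dominates
    the one-sided derivative of f at x. *)
Lemma convex_above_tangent x y :
  convex_function (edom psi : set (convex_lmodType E)) f ->
  edom psi x -> edom psi y -> f x + pairing (df x) (y - x) <= f y.
Proof.
move=> fc Qx Qy; rewrite -lerBrDl.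
have := diff01_le_slope (f_segment Qx Qy) (c := f y - f x).
rewrite scale0r addr0; apply => t /andP[/ltW t0 t1].
by rewrite [_ * t]mulrC (convex_function_segment fc)// t0.
Qed.

Lemma subgradient_objective x s :
  convex_function (edom psi : set (convex_lmodType E)) f ->
  edom psi x -> subgradient_dom x (s - df x) -> forall y, edom psi y ->
  f x + fine (psi x) + pairing s (y - x) <= f y + fine (psi y).
Proof.
move=> fc Qx sx y Qy; have := convex_above_tangent fc Qx Qy.
by have := sx y Qy; rewrite !pairingE; lra.
Qed.

(** The sum rule for subgradients in the direction that removes the smooth
    part: convexity bounds the variation of psi along a segment linearly, so
    the one-sided derivative of f at x must make up for the rest. *)
Lemma subdifferential_objective x s : edom psi x ->
  subdifferential (objective f psi) x s -> subgradient_dom x (s - df x).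
Proof.
move=> Qx [_ sx] y Qy.
suff : - pairing (df x) (y - x) <=
    - pairing s (y - x) + (fine (psi y) - fine (psi x)).
  by rewrite pairingDl pairingNl; lra.
have := diff01_le_slope (diff01N (f_segment Qx Qy))
  (c := - pairing s (y - x) + (fine (psi y) - fine (psi x))).
rewrite scale0r addr0; apply => t /andP[/ltW t0 t1].
have t01 : 0 <= t <= 1 by rewrite t0 t1.
have [Qt pt] := econvex_segment psi_proper psi_convex Qx Qy t01.
have := sx (x + t *: (y - x)); rewrite /objective.
rewrite -(fineK (edom_fin psi_proper Qx)) -(fineK (edom_fin psi_proper Qt)).
rewrite -!EFinD lee_fin (addrC x (t *: _)) addrK pairingZr (addrC (t *: _) x).
lra.
Qed.

Lemma newton_model_fin c x y : pos_semidef (d2f x) -> edom psi y ->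
  newton_model B psi df d2f c x y =
  (pairing (df x) (y - x) + 2^-1 * pairing (d2f x (y - x)) (y - x)
   + c / 2 * pairing (B (y - x)) (y - x) + fine (psi y))%:E.
Proof.
move=> H0 Qy; rewrite /newton_model !pnorm_sqr//; last exact: pos_def_semidef.
by rewrite -{1}(fineK (edom_fin psi_proper Qy)) -EFinD.
Qed.

(** Moving from the minimizer y a fraction t towards z changes the quadratic
    part of the model by a linear and a quadratic term in t and psi by at most
    t (psi z - psi y); the linear part must then be nonnegative. *)
Lemma newton_step_subgradient c x y : edom psi x ->
  self_adjoint (d2f x) -> pos_semidef (d2f x) ->
  is_argmin (edom psi) (newton_model B psi df d2f c x) y ->
  subgradient_dom y (- (df x + d2f x (y - x) + c *: B (y - x))).
Proof.
move=> Qx Hs Hp [Qy ymin] z Qz; rewrite pairingNl -subr_ge0.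
set d := y - x; set h := z - y.
pose b := 2^-1 * pairing (d2f x h) h + c / 2 * pairing (B h) h.
apply: (@ge0_first_order _ _ b) => t /andP[/ltW t0 t1].
have t01 : 0 <= t <= 1 by rewrite t0 t1.
have [Qt pt] := econvex_segment psi_proper psi_convex Qy Qz t01.
have := ymin _ Qt; rewrite !newton_model_fin// lee_fin -/d.
rewrite (_ : y + t *: (z - y) - x = d + t *: h); last by rewrite addrAC.
rewrite -/h in pt *; clearbody d h; move: pt; rewrite /b.
rewrite !linearD/= !linearZ/= !pairingE (Hs h d) (B_sa h d).
lra.
Qed.

(** The second derivative of t |-> <df (x + t h), v> is the third derivative of
    f at (h, h, v), bounded by M ||h||^2 ||v|| with the local norm of h at
    x + t h; that local norm grows at most exponentially in t. *)
Lemma qsc_gradient_error (M : R) x y v : 0 <= M ->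
  (forall z, edom psi z -> pos_semidef (d2f z)) ->
  quasi_self_concordant B (edom psi) d2f d3f M -> edom psi x -> edom psi y ->
  pairing (df y - df x - d2f x (y - x)) v <=
  M * (expR (M * pnorm B (y - x)) * pnorm (d2f x) (y - x) ^+ 2) / 2 * pnorm B v.
Proof.
move=> M0 Hp qsc Qx Qy; set h := y - x; set r := pnorm B h.
have Qt t : 0 <= t <= 1 -> edom psi (x + t *: h) by exact: edom_segment.
have r0 : 0 <= r by exact: pnorm_ge0.
have H0 : 0 <= pairing (d2f x h) h by exact: Hp.
have Hh t : 0 <= t <= 1 -> pairing (d2f (x + t *: h) h) h <=
    expR (M * r) * pairing (d2f x h) h.
  move=> t01; have t1 : t <= 1 by case/andP: t01.
  have := gronwall01 (d2f_segment h h Qx Qy) (c := M * r) _ t01.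
  rewrite scale0r addr0 => growth; apply: le_trans (growth _) _.
    move=> s s01; have := qsc _ (Qt s s01) h h.
    rewrite pnorm_sqr; last exact/Hp/Qt.
    by rewrite -/h -/r; lra.
  by rewrite ler_wpM2r// ler_expR ler_piMr// mulr_ge0.
have := diff01_le_quadratic (df_segment v Qx Qy) (d2f_segment h v Qx Qy)
  (c := M * (expR (M * r) * pairing (d2f x h) h) * pnorm B v).
rewrite scale0r scale1r addr0 [x + (y - x)]addrC subrK -/h.
rewrite pnorm_sqr; last exact: Hp.
rewrite !pairingDl !pairingNl => taylor; rewrite mulrAC; apply: taylor => t t01.
apply: le_trans (qsc _ (Qt t t01) h v) _.
rewrite pnorm_sqr; last exact/Hp/Qt.
by rewrite ler_wpM2r ?pnorm_ge0// ler_wpM2l// Hh.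
Qed.

End Composite.

(** * Convergence rate of the gap *)

Section Rate.
Context {R : realType}.

(** A logarithmic lower bound on squares replaces the arithmetic-geometric mean
    inequality: it is additive along products, hence can be summed step by
    step. It is the tangent bound exp z >= 1 + z at z = 1/2 + 2 ln r, weakened
    by exp(-1/2) >= 1/2; the tangency point r = exp(-1/4) is the threshold of
    the second regime. *)
Lemma sqr_ge_log (r : R) : 0 < r -> (3 / 2 + 2 * ln r) / 2 <= r ^+ 2.
Proof.
move=> r0; have e0 : 1 / 2 <= expR (- (1 / 2)) :> R.
  by apply: le_trans (expR_ge1Dx _); lra.
have -> : r ^+ 2 = expR (- (1 / 2)) * expR (1 / 2 + 2 * ln r).
  by rewrite -expRD addKr -powR_mulrn ?ltW// /powR gt_eqF.
have := expR_ge1Dx (1 / 2 + 2 * ln r).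
have := expR_ge0 (1 / 2 + 2 * ln r).
nra.
Qed.

(** The sum of the logarithms of the ratios g (k+1) / g k telescopes. *)
Lemma decrease_log_ratio (F g : nat -> R) (c : R) : 0 <= c ->
  (forall k, 0 <= F k) ->
  (forall k, 0 < g k.+1 ->
     0 < g k /\ F k.+1 <= F k * (1 - c * (g k.+1 / g k) ^+ 2)) ->
  forall k, 0 < g k ->
  F k <=
  expR (- (c / 2 * (3 / 2 * k%:R + 2 * (ln (g k) - ln (g 0%N))))) * F 0%N.
Proof.
move=> c0 F0 Fg; elim=> [g0|k IH gS].
  by rewrite subrr !mulr0 addr0 mulr0 oppr0 expR0 mul1r.
have [gk FS] := Fg k gS; apply: le_trans FS _.
have rho0 : 0 < g k.+1 / g k by rewrite divr_gt0.
have := sqr_ge_log rho0; rewrite ln_div ?posrE// => rho.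
have step : 1 - c * (g k.+1 / g k) ^+ 2 <=
    expR (- (c / 2 * (3 / 2 + 2 * (ln (g k.+1) - ln (g k))))).
  apply: le_trans (expR_ge1Dx _) _; rewrite ler_expR lerN2.
  by rewrite -mulrA ler_wpM2l// mulrC.
apply: le_trans (ler_wpM2l (F0 k) step) _.
apply: le_trans (ler_wpM2r (expR_ge0 _) (IH gk)) _.
rewrite mulrAC -expRD le_eqVlt; apply/orP; left; apply/eqP.
by congr (expR _ * _); rewrite -natr1; field.
Qed.

(** Either g has decayed like exp(-k/4), and F k <= g k * D is enough, or the
    logarithm of g k / g 0 is at least -k/4 and the exponent of
    [decrease_log_ratio] is at most -ck/2 with c = 1 / (4MD). *)
Lemma linear_or_gradient_rate (F g : nat -> R) (M D : R) : 0 < M -> 0 < D ->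
  (forall k, 0 <= F k) -> (forall k, 0 <= g k) ->
  (forall k, F k <= g k * D) ->
  (forall k, 0 < g k.+1 ->
     0 < g k /\ g k.+1 ^+ 2 / (4 * M * g k) <= F k - F k.+1) ->
  forall k, F k <= expR (- (k%:R / (8 * M * D))) * F 0%N
                   + expR (- (k%:R / 4)) * g 0%N * D.
Proof.
move=> M0 D0 F0 g0 FgD Fg k.
have [small|large] := leP (g k) (expR (- (k%:R / 4)) * g 0%N).
  apply: le_trans (FgD k) _; rewrite -[leLHS]add0r lerD//.
    by rewrite mulr_ge0// expR_ge0.
  by rewrite ler_pM2r.
have gk : 0 < g k by apply: le_lt_trans large; rewrite mulr_ge0// expR_ge0.
rewrite -[leLHS]addr0 lerD//; last by rewrite !mulr_ge0// ?expR_ge0// ltW.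
pose c := (4 * M * D)^-1.
have c0 : 0 < c by rewrite invr_gt0 !mulr_gt0.
have FS i : 0 < g i.+1 ->
    0 < g i /\ F i.+1 <= F i * (1 - c * (g i.+1 / g i) ^+ 2).
  move=> /Fg[gi Fi]; split=> //.
  have : F i * (c * (g i.+1 / g i) ^+ 2) <= g i.+1 ^+ 2 / (4 * M * g i).
    have -> : g i.+1 ^+ 2 / (4 * M * g i) =
        (g i * D) * (c * (g i.+1 / g i) ^+ 2).
      by rewrite /c; field; rewrite !gt_eqF.
    by rewrite ler_wpM2r// mulr_ge0 ?sqr_ge0 ?ltW.
  by rewrite mulrBr mulr1; lra.
have g00 : 0 < g 0%N.
  rewrite lt_neqAle g0 andbT eq_sym; apply: contraTneq gk => g00.
  rewrite -leNgt; elim: k {large} => [|i IH]; first by rewrite g00.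
  by rewrite leNgt; apply/negP => /FS[]; rewrite ltNge IH.
apply: le_trans (decrease_log_ratio (ltW c0) F0 FS gk) _.
rewrite ler_wpM2r// ler_expR lerN2.
have : - (k%:R / 4) <= ln (g k) - ln (g 0%N).
  rewrite -ln_div ?posrE// -[leLHS]expRK ler_ln ?posrE ?expR_gt0 ?divr_gt0//.
  by rewrite ler_pdivlMr// ltW.
have -> : k%:R / (8 * M * D) = c / 2 * k%:R.
  by rewrite /c; field; rewrite !gt_eqF.
by move=> H; rewrite ler_wpM2l ?divr_ge0 ?(ltW c0)//; lra.
Qed.

End Rate.

(** * Progress of the constant regularization *)

Section Step.
Context {R : realType} {E : vectType R}.

Lemma dnorm_dual (B : 'Hom(E, 'Hom(E, R^o))) (w : E) :
  self_adjoint B -> pos_def B -> dnorm B (B w) = pnorm B w.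
Proof.
by move=> Bs Bp; rewrite /dnorm Bs pos_def_lfunVK.
Qed.

Lemma dnormD_dual_sqr (B : 'Hom(E, 'Hom(E, R^o))) s (c : R) (h : E) :
  self_adjoint B -> pos_def B ->
  dnorm B (s + c *: B h) ^+ 2 =
    dnorm B s ^+ 2 + 2 * c * pairing s h + c ^+ 2 * pnorm B h ^+ 2.
Proof.
move=> Bs Bp; have B0 := pos_def_semidef Bp.
pose u := (B^-1)%VF s; have -> : s = B u by rewrite pos_def_lfunVK.
rewrite -linearZ -linearD/= !dnorm_dual// !pnorm_sqr//.
by rewrite !linearD/= !linearZ/= !pairingE (Bs h u); ring.
Qed.

(** With h = y - x, the new gradient is s' = Delta - M g B h where Delta is the
    linearization error. Expanding ||Delta||_*^2 = ||s' + M g B h||_*^2 shows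
    that the claim follows from ||Delta||_* <= M g ||h||. The product form of
    the conclusion covers M g = 0, where it says that s' = 0. *)
Lemma constant_step_progress (B : 'Hom(E, 'Hom(E, R^o))) (psi : E -> \bar R)
    (f : E -> R) df d2f d3f (M g : R) (x y : E) s s' :
  self_adjoint B -> pos_def B -> eproper psi -> econvex psi ->
  thrice_diff_on B (edom psi) f df d2f d3f ->
  (forall z, edom psi z -> self_adjoint (d2f z)) ->
  (forall z, edom psi z -> pos_semidef (d2f z)) ->
  0 <= M -> quasi_self_concordant B (edom psi) d2f d3f M ->
  edom psi x -> subgradient_dom psi x (s - df x) ->
  g = dnorm B s ->
  is_argmin (edom psi) (newton_model B psi df d2f (M * g) x) y ->
  s' = df y - df x - d2f x (y - x) - (M * g) *: B (y - x) ->
  dnorm B s' ^+ 2 <= 2 * M * g * pairing s' (x - y).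
Proof.
move=> Bs Bp pp pc fd Hs Hp M0 qsc Qx sx gE ymin s'E.
have [Qy _] := ymin; pose h := y - x; pose r := pnorm B h.
have g0 : 0 <= g by rewrite gE dnorm_ge0.
have r0 : 0 <= r by exact: pnorm_ge0.
(* Add the subgradient inequalities of psi at x and at y. *)
have decr : pnorm (d2f x) h ^+ 2 + M * g * r ^+ 2 <= g * r.
  have := newton_step_subgradient Bs Bp pp pc Qx (Hs _ Qx) (Hp _ Qx) ymin Qx.
  have := sx y Qy; have := pairing_le_dnorm s (- h) Bs Bp.
  rewrite pnormN -gE -/r -(opprB y x) -/h !pnorm_sqr; last 2 first.
  - exact: pos_def_semidef.
  - exact: Hp.
  by rewrite !pairingE; lra.
pose Delta := df y - df x - d2f x h.
have Delta_le : dnorm B Delta <= M * g * r.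
  apply: dnorm_le => // [|v]; first by rewrite !mulr_ge0.
  apply: le_trans (qsc_gradient_error pp pc fd v M0 Hp qsc Qx Qy) _.
  rewrite -/h -/r ler_wpM2r ?pnorm_ge0//.
  have : expR (M * r) * pnorm (d2f x) h ^+ 2 <= g * r.
    rewrite mulrC -ler_pdivlMr ?expR_gt0// -expRN.
    (* exp (M r) (1 - M r) <= 1 whatever the sign of 1 - M r. *)
    apply: (@le_trans _ _ (g * r * (1 - M * r))); first by move: decr; lra.
    by rewrite ler_wpM2l ?mulr_ge0//; exact: expR_ge1Dx.
  move=> /(ler_wpM2l M0); have : 0 <= M * (g * r) by rewrite !mulr_ge0.
  lra.
have : dnorm B Delta ^+ 2 <= (M * g * r) ^+ 2.
  by rewrite ler_sqr ?nnegrE ?dnorm_ge0// !mulr_ge0.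
have -> : Delta = s' + (M * g) *: B h by rewrite s'E subrK.
rewrite dnormD_dual_sqr// -/r -(opprB y x) -/h pairingNr; lra.
Qed.

End Step.

Lemma lee_sqr_div (R : realType) (a b c : R) : 0 <= b ->
  ((a ^+ 2)%:E / b%:E <= c%:E)%E =
  if b == 0 then (a == 0) && (0 <= c) else a ^+ 2 <= b * c.
Proof.
move=> b0; have [->|bn] := eqVneq b 0.
  rewrite inve0; have [->|a0] := eqVneq a 0.
    by rewrite expr0n/= mul0e lee_fin.
  by rewrite gt0_muley// lte_fin lt_neqAle eq_sym sqrf_eq0 a0 sqr_ge0.
have bp : 0 < b by rewrite lt_neqAle eq_sym bn.
by rewrite inver (negPf bn) -EFinM lee_fin ler_pdivrMr// mulrC.
Qed.

(** * The global linear rate *)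

Theorem theorem3p3 (R : realType) (E : vectType R)
  (B : 'Hom(E, 'Hom(E, R^o))) (psi : E -> \bar R) (f : E -> R)
  (df : E -> 'Hom(E, R^o)) (d2f : E -> 'Hom(E, 'Hom(E, R^o)))
  (d3f : E -> 'Hom(E, 'Hom(E, 'Hom(E, R^o)))) (M : R)
  (B_sa : self_adjoint B) (B_pd : pos_def B)
  (psi_proper : eproper psi) (psi_convex : econvex psi)
  (psi_closed : eclosed B psi)
  (f_convex : convex_function (edom psi : set (convex_lmodType E)) f)
  (f_diff : thrice_diff_on B (edom psi) f df d2f d3f)
  (d2f_sa : forall x, edom psi x -> self_adjoint (d2f x))
  (d2f_psd : forall x, edom psi x -> pos_semidef (d2f x))
  (d3f_sym : forall x, edom psi x -> trilinear_sym (d3f x))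
  (M_ge0 : 0 <= M)
  (f_qsc : quasi_self_concordant B (edom psi) d2f d3f M)
  (solvable : exists xstar, is_argmin (edom psi) (objective f psi) xstar)
  (x : nat -> E) (F' : nat -> 'Hom(E, R^o)) (g sigma : nat -> R)
  (run : newton_grad_reg B f psi df d2f x F' g sigma) :
  let F := objective f psi in
  let Fstar := optimal_value F in
  let D := sublevel_diameter B (edom psi) F (x 0%N) in
  ((forall k, 0 <= sigma k <= 2 * M) ->
   (forall k, sufficient_progress x F' g sigma k) ->
   (D < +oo)%E ->
   forall k : nat, (1 <= k)%N ->
     (* in \bar R: k / 0 = +oo and expeR -oo = 0 if M = 0 or D = 0 *)
     (F (x k) - Fstar
        <= expeR (- (k%:R%:E / (8%:R%:E * M%:E * D))) * (F (x 0%N) - Fstar)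
           + (expR (- (k%:R / 4)) * g 0%N)%:E * D)%E)
  /\
  ((forall k, sigma k = M) -> forall k, sufficient_progress x F' g sigma k).
Proof.
move=> F Fstar D.
have [x0Q F'0 gE sigma0 step F'S] := run.
have Qx k : edom psi (x k) by case: k => // k; have [] := step k.
have g0 k : 0 <= g k by rewrite gE dnorm_ge0.
have sg0 k : 0 <= 2 * sigma k * g k by rewrite !mulr_ge0.
have psi_sub k : subgradient_dom psi (x k) (F' k - df (x k)).
  case: k => [|k]; first exact: (subdifferential_objective psi_proper _ f_diff).
  have := newton_step_subgradient B_sa B_pd psi_proper psi_convex (Qx k)
    (d2f_sa _ (Qx k)) (d2f_psd _ (Qx k)) (step k).
  congr (subgradient_dom _ _ _); rewrite F'S !opprD.
  by rewrite [RHS]addrC !addrA addNr add0r.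
split; last first.
  move=> sM k.
  have := constant_step_progress B_sa B_pd psi_proper psi_convex f_diff d2f_sa
    d2f_psd M_ge0 f_qsc (Qx k) (psi_sub k) (gE k).
  move: (step k) (F'S k); rewrite sM => st F'k /(_ _ _ st F'k); rewrite -gE.
  rewrite /sufficient_progress sM lee_sqr_div; last by rewrite !mulr_ge0.
  (* If M * g k = 0, the quotient is finite only if the new gradient is 0. *)
  case: eqP => // ->; rewrite mul0r => gS0.
  have gS : g k.+1 == 0 by rewrite -sqrf_eq0 eq_le gS0 sqr_ge0.
  rewrite gS; move: gS; rewrite gE dnorm_eq0// => /eqP ->.
  by rewrite /pairing zero_lfunE/=.
move=> sM prog Doo k k1.
have [xs [Qs xsmin]] := solvable.
pose Fr z := f z + fine (psi z).
have FE z : edom psi z -> F z = (Fr z)%:E.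
  by move=> Qz; rewrite /F /objective -{1}(fineK (edom_fin psi_proper Qz)).
have Fmin z : edom psi z -> Fr xs <= Fr z.
  by move=> Qz; rewrite -lee_fin -!FE//; exact: xsmin.
have FstarE : Fstar = (Fr xs)%:E.
  rewrite -FE//; apply/eqP; rewrite eq_le; apply/andP; split.
    by apply: ereal_inf_lbound; exists xs => //; rewrite /edom/= FE// ltry.
  apply: le_ereal_inf_tmp => _ [z Fz <-]; apply: xsmin.
  move: Fz; rewrite /edom/= /F /objective.
  by case: (psi z) => [r||]; rewrite ?ltry ?addey ?ltNyr.
have F'sub i z : edom psi z -> Fr (x i) + pairing (F' i) (z - x i) <= Fr z.
  move=> Qz.
  exact: (subgradient_objective psi_proper psi_convex f_diff f_convex).
have progr i : if 2 * sigma i * g i == 0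
    then (g i.+1 == 0) && (0 <= pairing (F' i.+1) (x i - x i.+1))
    else g i.+1 ^+ 2 <= 2 * sigma i * g i * pairing (F' i.+1) (x i - x i.+1).
  by rewrite -lee_sqr_div//; exact: prog.
have Fdecr i : Fr (x i.+1) <= Fr (x i).
  apply: le_trans (F'sub i.+1 (x i) (Qx i)); rewrite lerDl.
  have := progr i; case: eqP => [_ /andP[]//|/eqP n0].
  move=> /(le_trans (sqr_ge0 _)); rewrite pmulr_rge0//.
  by rewrite lt_neqAle eq_sym n0 sg0.
have F0 i : Fr (x i) <= Fr (x 0%N).
  by elim: i => // i; exact: le_trans.
have dist_le y z : edom psi y -> edom psi z -> Fr y <= Fr (x 0%N) ->
    Fr z <= Fr (x 0%N) -> ((pnorm B (y - z))%:E <= D)%E.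
  move=> Qy Qz Fy Fz; apply: ereal_sup_ubound; exists y, z.
  by rewrite -/F !FE ?lee_fin.
have D0 : (0 <= D)%E.
  by apply: le_trans (dist_le _ _ x0Q x0Q _ _); rewrite // lee_fin pnorm_ge0.
have [d DE] : exists d, D = d%:E.
  by exists (fine D); rewrite fineK// ge0_fin_numE.
have d0 : 0 <= d by rewrite -lee_fin -DE.
have FgD i : Fr (x i) - Fr xs <= g i * d.
  have := F'sub i xs Qs.
  have := pairing_le_dnorm (F' i) (- (xs - x i)) B_sa B_pd.
  rewrite -gE pairingNr opprB.
  have : g i * pnorm B (x i - xs) <= g i * d.
    rewrite ler_wpM2l// -lee_fin -DE; apply: dist_le => //; exact: Fmin.
  lra.
rewrite !FE// FstarE DE -!EFinB.
have rhs0 : (0 <= expeR (- (k%:R%:E / (8%:R%:E * M%:E * d%:E))) *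
    (Fr (x 0%N) - Fr xs)%:E + (expR (- (k%:R / 4)) * g 0%N)%:E * d%:E)%E.
  apply: adde_ge0; apply: mule_ge0; rewrite ?expeR_ge0 ?lee_fin//.
    by rewrite subr_ge0 Fmin.
  by rewrite mulr_ge0 ?expR_ge0.
(* This disposes of D = 0, of g k = 0, and, as a positive g k with k >= 1
   forces M > 0, of M = 0: the quotient in the exponent is then real. *)
have [gd0|gd0] := eqVneq (g k * d) 0.
  by apply: le_trans rhs0; rewrite lee_fin -gd0.
have gS i : 0 < g i.+1 -> [/\ 0 < M, 0 < g i &
    g i.+1 ^+ 2 / (4 * M * g i) <= (Fr (x i) - Fr xs) - (Fr (x i.+1) - Fr xs)].
  move=> gi1; have := progr i; case: eqP => [_|/eqP n0 gP].
    by rewrite gt_eqF.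
  have [s0 g'0] : sigma i != 0 /\ g i != 0.
    by move: n0; rewrite !mulf_eq0 !negb_or => /andP[/andP[_ ->] ->].
  have gp : 0 < g i by rewrite lt_neqAle eq_sym g'0 g0.
  have sp : 0 < sigma i by rewrite lt_neqAle eq_sym s0 sigma0.
  have /andP[_ sM2] := sM i.
  have Mp : 0 < M by lra.
  split=> //; rewrite ler_pdivrMr ?mulr_gt0// opprB addrA subrK.
  apply: le_trans gP _.
  have sub := F'sub i.+1 (x i) (Qx i).
  have dF : 0 <= Fr (x i) - Fr (x i.+1) by rewrite subr_ge0 Fdecr.
  apply: (@le_trans _ _ (2 * sigma i * g i * (Fr (x i) - Fr (x i.+1)))).
    by rewrite ler_wpM2l// lerBrDl.
  rewrite [leRHS]mulrC ler_wpM2r// ler_wpM2r//; lra.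
have [gk dn] : 0 < g k /\ 0 < d.
  move: gd0; rewrite mulf_eq0 negb_or !lt_neqAle !(eq_sym 0) g0 d0.
  by move=> /andP[-> ->].
have Mp : 0 < M by case: k k1 gk {rhs0 gd0} => // j _ /gS[].
rewrite -!EFinM inver gt_eqF ?mulr_gt0//= lee_fin.
apply: (@linear_or_gradient_rate R (fun i => Fr (x i) - Fr xs)) => // i.
  by rewrite subr_ge0 Fmin.
by move=> /gS[].
Qed.
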